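(* For any integer $m\ge 2$ and any positive real number $x$, $$I_m(x)\le 4\, m^{\frac13}\, x^{\frac23+\frac{1}{25\log q_m}},$$ where $q_m$ is the least prime factor of $m$.
   Context: For a positive integer $n$, let $H_n = 1+\frac12+\frac13+\cdots+\frac1n$ be the $n$-th harmonic number, written in lowest terms as $H_n = u_n/v_n$ with $u_n, v_n$ integers, $\gcd(u_n,v_n)=1$ and $v_n>0$. For a positive integer $m$, let $I_m$ be the set of positive integers $n$ such that $m\nmid v_n$. For a set $S$ of positive integers and a real number $x$, $S(x)=|S\cap[1,x]|$; in particular $I_m(x)=|I_m\cap[1,x]|$. $\log$ is the natural logarithm. *)

(* Defs.v *)
From mathcomp Require Import all_boot all_order all_algebra finmap.
From mathcomp Require Import boolp classical_sets cardinality reals.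

Set Implicit Arguments.
Unset Strict Implicit.
Unset Printing Implicit Defensive.
Import Order.TTheory GRing.Theory Num.Theory.
Local Open Scope classical_set_scope.
Local Open Scope ring_scope.

Definition harmonic_number (n : nat) : rat := \sum_(1 <= k < n.+1) k%:R^-1.

(* [denq] is the positive denominator of the reduced fraction. *)
Definition harmonic_denom (n : nat) : int := denq (harmonic_number n).

Definition I_set (m : nat) : set nat :=
  [set n | (0 < n)%N /\ ~~ (m%:Z %| harmonic_denom n)%Z].

(* [fset_set] is only meaningful on finite sets; the set below is finite, being
   bounded by [x]. *)
Definition counting (R : realType) (S : set nat) (x : R) : nat :=
  #|` fset_set (S `&` [set n | 1 <= (n%:R : R) <= x]) |%fset.

(* Main.v *)
Require Import Defs.
From mathcomp Require Import all_boot all_order all_algebra finmap.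
From mathcomp Require Import boolp classical_sets cardinality.
From mathcomp Require Import reals sequences exp.
From mathcomp Require Import ring lra zify.

(** Fix a prime [p] and write [n_s] for [n %/ p ^ s].  The terms of
    [p ^ s * H_n] whose index is not divisible by [p ^ s] vanish modulo [p],
    and the others add up to [H_(n_s)]; hence if [p ^ a] does not divide the
    denominator of [H_n], then [p] divides the numerator of [H_(n_s)] for every
    [s >= a] ([I_set_quotient]).  So, apart from its [a] lowest base-[p] digits,
    [n] is built by appending digits one at a time in such a way that [p] always
    divides the numerator of the harmonic number reached ([H_0 = 0] included).

    How many last digits are possible?  If [p] divides the numerators of [H_r]
    and [H_(r+d)], where [0 < d < p], then [r] is a root modulo [p] of the
    derivative of [(X + 1) ... (X + d)], a nonzero polynomial of degree [d - 1].
    Among [p] consecutive integers every distance [d] therefore occurs at most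
    [d - 1] times, so good indices are sparse: about [D^2 / 2] of them need a
    length of about [D^3 / 3].  The exact outcome is [8 N^3 <= 9 L^2] for [N]
    good indices among [L <= p] consecutive integers ([count_harmonic_block]).

    For [L = p], [N <= (9/8)^(1/3) p^(2/3)], and [9/8 <= e^(3/25)] turns
    this into [N <= p ^ t] where [t = 2/3 + 1 / (25 log p)]: this is where the
    exponent comes from.  Multiplying over the digits gives at most [2 M ^ t]
    good indices up to [M] ([harmonic_tree_count]), and restoring the [a] free
    digits gives at most [2 (p^a)^(1/3) N ^ t] elements of [I_(p^a)] up to [N]
    ([I_set_prime_power_count]).

    Finally [I_m] is the union of the [I_(p^a)] over the prime powers [p^a]
    exactly dividing [m].  With [k] distinct primes, [m / p^a >= 2^(k-1)], and
    [k^3 <= 2^(k+2)], so that [k (p^a)^(1/3) <= 2 m^(1/3)]: each of the [k]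
    terms is at most [1/k] of the claimed bound. *)

Set Implicit Arguments.
Unset Strict Implicit.
Unset Printing Implicit Defensive.
Import Order.TTheory GRing.Theory Num.Theory.
Local Open Scope ring_scope.

(** * Sets of integers in which short distances are rare *)

Lemma sum_pairmap_subn (x : nat) (s : seq nat) : path ltn x s ->
  (\sum_(g <- pairmap (fun a b => b - a) x s) g + x = last x s)%N.
Proof.
elim: s x => [|y s IH] x /=; first by rewrite big_nil.
by case/andP=> xy /IH <-; rewrite big_cons; lia.
Qed.

Lemma count_gap_le (d x : nat) (s : seq nat) : path ltn x s ->
  (count_mem d (pairmap (fun a b => b - a) x s)
     <= count (fun r => (r + d)%N \in x :: s) (x :: s))%N.
Proof.
elim: s x => [|y s IH] x //= /andP[xy ys].
apply: (@leq_trans ((y - x == d) +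
   count (fun r => (r + d)%N \in y :: s) (y :: s))%N).
  by rewrite leq_add2l IH.
apply: leq_add.
  case: eqP => //= <-; rewrite !inE subnKC ?eqxx ?orbT //; exact: ltnW.
by apply: (@sub_count _ _ _ _ (y :: s)) => r rs; rewrite !inE in rs *; rewrite rs orbT.
Qed.

Lemma sum_trunc_gaps (D : nat) (gs : seq nat) :
  (\sum_(g <- gs) (D - g) = \sum_(0 <= d < D) (D - d) * count_mem d gs)%N.
Proof.
elim: gs => [|g gs IH]; first by rewrite big_nil big1 // => i _; rewrite /= muln0.
rewrite big_cons IH /=.
under [RHS]eq_bigr => d _ do rewrite mulnDr.
rewrite big_split /=; congr addn.
have [gD|Dg] := ltnP g D.
  rewrite (bigD1_seq g) ?mem_index_iota ?iota_uniq //= eqxx muln1 big1 ?addn0 //.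
  by move=> d dg; rewrite eq_sym (negbTE dg) muln0.
have -> : (D - g = 0)%N by apply/eqP; rewrite subn_eq0.
rewrite big_nat_cond big1 //.
move=> d /andP[/andP[_ dD] _]; case: eqP => [|_]; [lia|by rewrite muln0].
Qed.

Lemma sum_sub_pred_binomial (D : nat) :
  (\sum_(0 <= d < D) (D - d) * d.-1 = 'C(D, 3))%N.
Proof.
elim: D => [|D IH]; first by rewrite big_geq.
rewrite binS -IH.
have -> : 'C(D, 2) = (\sum_(0 <= d < D.+1) d.-1)%N.
  elim: D {IH} => [|D IH2]; first by rewrite big_nat1.
  by rewrite big_nat_recr //= -IH2 binS bin1 addnC.
rewrite !big_nat_recr //= addnA; congr addn; last by rewrite subSn // subnn mul1n.
rewrite -big_split /=; apply: eq_big_nat => d /andP[_ dD].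
by rewrite subSn ?mulSn 1?addnC // ltnW.
Qed.

(** Each gap [g] satisfies [D <= g + (D - g)].  Summed over the gaps, [g] gives
    the length of the sequence, while the truncated excess [D - g] only sees the
    distances [d < D] and is at most the sum of the [(D - d) * (d - 1)]. *)
Lemma sparse_sorted_span (D x : nat) (s : seq nat) : path ltn x s ->
  (forall d, (0 < d < D)%N ->
     (count (fun r => (r + d)%N \in x :: s) (x :: s) <= d.-1)%N) ->
  (D * size s + x <= last x s + 'C(D, 3))%N.
Proof.
move=> xs sparse.
rewrite -(sum_pairmap_subn xs) -addnA (addnC x) addnA leq_add2r.
set gs := pairmap _ x s.
have <- : size gs = size s by rewrite size_pairmap.
have -> : (D * size gs = \sum_(g <- gs) D)%N by rewrite big_const_seq count_predT iter_addn_0.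
apply: (@leq_trans (\sum_(g <- gs) (g + (D - g)))%N).
  by apply: leq_sum => g _; rewrite -leq_subLR.
rewrite big_split leq_add2l /= sum_trunc_gaps -sum_sub_pred_binomial.
rewrite big_nat_cond [leqRHS]big_nat_cond.
apply: leq_sum => d /andP[/andP[_ dD] _]; rewrite leq_mul2l; apply/orP; right.
case: d dD => [_|d dD].
  rewrite leqn0; apply/eqP/count_memPn; rewrite /gs.
  elim: (s) (x) xs => [|y s' IH] z //= /andP[zy ys]; rewrite inE negb_or IH // andbT.
  by rewrite eq_sym subn_eq0 -ltnNge.
by apply: leq_trans (count_gap_le d.+1 xs) _; apply: sparse.
Qed.

(** The best linear bound is the one with [D] close to the square root of
    [2 (N + 1)]: its cubic correction ['C(D, 3)] is then about [D^3 / 6], whence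
    [t] is at least about [D^3 / 3].  The lower order terms outweigh the rounding
    of [D] as soon as [3 <= D]; the values [N <= 3] are checked one by one. *)
Lemma span_cubic_bound (N t : nat) :
  (forall D, D * N <= t + 'C(D, 3))%N -> (8 * N.+1 ^ 3 <= 9 * t.+1 ^ 2)%N.
Proof.
move=> span.
have [N4|N4] := leqP N 3.
  have := span 2; have := span 3; rewrite binn bin_small // addn0 addn1.
  have low s : (s <= t.+1 -> 9 * s ^ 2 <= 9 * t.+1 ^ 2)%N.
    by rewrite leq_mul2l leq_exp2r.
  case: N N4 {span} => [|[|[|[|]]]] // _ h3 h2.
  - by apply: leq_trans (low 1%N _).
  - by apply: leq_trans (low 3%N _); last lia.
  - by apply: leq_trans (low 5%N _); last lia.
  - by apply: leq_trans (low 9%N _); last lia.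
have [D /andP[DM MD]] : exists D, (D ^ 2 <= 2 * N.+1 < D.+1 ^ 2)%N.
  exists (Nat.sqrt (2 * N.+1)); have := PeanoNat.Nat.sqrt_spec (2 * N.+1); lia.
have D3 : (3 <= D)%N.
  by rewrite -ltnS -(@ltn_exp2r _ _ 2) // (leq_ltn_trans _ MD) //; lia.
have Cspan := span D.
have C6 : ('C(D, 3) * 6 = D * D.-1 * D.-2)%N.
  by rewrite -[6%N]/(3`!) bin_ffact /falling_factorial /= muln1 mulnA.
(* With [M := 2 * N.+1 = D ^ 2 + e], the bound for [D] reads
   [6 * t.+1 >= 2 * D ^ 3 + 3 * D * e + w], and the goal is
   [(6 * t.+1) ^ 2 >= 4 * M ^ 3]. *)
pose e := (2 * N.+1 - D ^ 2)%N.
have eE : (2 * N.+1 = D ^ 2 + e)%N by rewrite /e subnKC.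
have e_le : (e <= 2 * D)%N.
  by rewrite -(leq_add2l (D ^ 2)) -eE -ltnS (leq_trans MD) // -addn1 sqrnD muln1 ?exp1n; lia.
pose w := (3 * D ^ 2 + 6 - 8 * D)%N.
have wE : (w + 8 * D = 3 * D ^ 2 + 6)%N by rewrite /w subnK // -mulnn; nia.
have w1 : (3 * D <= w)%N by rewrite -mulnn in wE; nia.
have w2 : (D ^ 2 <= w)%N by rewrite -mulnn in wE *; nia.
have T6 : (2 * D ^ 3 + 3 * D * e + w <= 6 * t.+1)%N.
  have {}C6 : ('C(D, 3) * 6 + 3 * D ^ 2 = D ^ 3 + 2 * D)%N.
    rewrite C6; case: (D) D3 => [|[|[|k]]] //= _; ring.
  have D3E : (D * D ^ 2 = D ^ 3)%N by rewrite -expnS.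
  have : (D * (2 * N.+1) = D ^ 3 + D * e)%N by rewrite eE mulnDr D3E.
  lia.
clearbody e w.
suff : (4 * (2 * N.+1) ^ 3 <= (6 * t.+1) ^ 2)%N by rewrite !expnMn; lia.
rewrite eE; apply: (@leq_trans ((2 * D ^ 3 + 3 * D * e + w) ^ 2)); last first.
  by rewrite leq_exp2r.
(* In the difference of the two sides the terms [D ^ 6] and [D ^ 4 * e] cancel;
   [h1] and [h2] absorb the negative remainder. *)
have h1 : (3 * D ^ 2 * e ^ 2 <= 4 * D ^ 3 * w)%N.
  apply: (@leq_trans (3 * D ^ 2 * (2 * D) ^ 2)%N).
    by rewrite leq_mul2l leq_exp2r // e_le orbT.
  have -> : (3 * D ^ 2 * (2 * D) ^ 2 = 4 * D ^ 3 * (3 * D))%N by ring.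
  by rewrite leq_mul2l w1 orbT.
have h2 : (4 * e ^ 3 <= 6 * D * e * w)%N.
  apply: (@leq_trans (4 * e * (2 * D) ^ 2)%N).
    by rewrite expnS mulnA leq_mul2l leq_exp2r // e_le orbT.
  apply: (@leq_trans (6 * D * e * D ^ 2)%N); last by rewrite leq_mul2l w2 orbT.
  have -> : (4 * e * (2 * D) ^ 2 = 16 * (e * D ^ 2))%N by ring.
  have -> : (6 * D * e * D ^ 2 = 6 * D * (e * D ^ 2))%N by ring.
  by rewrite leq_mul2r; apply/orP; right; lia.
have -> : (4 * (D ^ 2 + e) ^ 3 = 4 * D ^ 6 + 12 * D ^ 4 * e
   + 9 * (D ^ 2 * e ^ 2) + (3 * D ^ 2 * e ^ 2 + 4 * e ^ 3))%N by ring.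
have -> : ((2 * D ^ 3 + 3 * D * e + w) ^ 2 = 4 * D ^ 6 + 12 * D ^ 4 * e
   + 9 * (D ^ 2 * e ^ 2) + (4 * D ^ 3 * w + 6 * D * e * w) + w ^ 2)%N by ring.
by rewrite (leq_trans _ (leq_addr _ _)) // leq_add2l leq_add.
Qed.

(** * Harmonic numbers modulo a prime *)

(** The rationals of positive [p]-adic valuation, together with [0]. *)
Definition num_dvd (p : nat) (z : rat) := (p%:Z %| numq z)%Z.

Section PAdic.
Variables (p : nat) (p_prime : prime p).

Lemma Euclid_dvdz (a b : int) : (p%:Z %| a * b)%Z = (p%:Z %| a)%Z || (p%:Z %| b)%Z.
Proof. by rewrite !dvdzE abszM Euclid_dvdM. Qed.

(** A fraction need not be reduced to be tested, which makes closure under the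
    ring operations a computation. *)
Lemma num_dvdP (z : rat) : reflect
  (exists a b : int, [/\ (p%:Z %| a)%Z, ~~ (p%:Z %| b)%Z & z = a%:~R / b%:~R])
  (num_dvd p z).
Proof.
apply: (iffP idP) => [pz|[a [b [pa pb ->]]]].
  exists (numq z), (denq z); split => //; last by rewrite divq_num_den.
  apply/negP => pd; have := coprime_num_den z; apply/negP.
  rewrite /coprime neq_ltn; apply/orP; right.
  apply: leq_trans (prime_gt1 p_prime) _; apply: dvdn_leq.
    by rewrite gcdn_gt0 [in X in _ || X]absz_gt0 denq_neq0 orbT.
  by rewrite dvdn_gcd; move: pz pd; rewrite /num_dvd !dvdzE => -> ->.
have b0 : b%:~R != 0 :> rat by rewrite intr_eq0; apply: contraNneq pb => ->; rewrite dvdz0.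
pose y : rat := a%:~R / b%:~R.
have : numq y * b = a * denq y.
  apply/eqP; rewrite -(eqr_int rat) !rmorphM /= numqE mulrAC.
  by rewrite /y mulfVK.
move=> /(congr1 (fun k => (p%:Z %| k)%Z)); rewrite !Euclid_dvdz pa (negbTE pb) orbF.
by rewrite /num_dvd => ->.
Qed.

Lemma num_dvdD (y z : rat) : num_dvd p y -> num_dvd p z -> num_dvd p (y + z).
Proof.
move=> /num_dvdP[a [b [pa pb ->]]] /num_dvdP[c [d [pc pd ->]]].
have nz (e : int) : ~~ (p%:Z %| e)%Z -> e%:~R != 0 :> rat.
  by rewrite intr_eq0; apply: contraNneq => ->; rewrite dvdz0.
apply/num_dvdP; exists (a * d + c * b), (b * d); split.
- by rewrite rpredD ?dvdz_mulr.
- by rewrite Euclid_dvdz negb_or pb.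
- by rewrite addf_div ?nz // rmorphD !rmorphM.
Qed.

Lemma num_dvdN (z : rat) : num_dvd p (- z) = num_dvd p z.
Proof. by rewrite /num_dvd numqN !dvdzE abszN. Qed.

Lemma num_dvdB (y z : rat) : num_dvd p y -> num_dvd p z -> num_dvd p (y - z).
Proof. by move=> py pz; rewrite num_dvdD // num_dvdN. Qed.

Lemma num_dvd_int (k : int) : num_dvd p k%:~R = (p%:Z %| k)%Z.
Proof. by rewrite /num_dvd numq_int. Qed.

Lemma num_dvdMz (k : int) (z : rat) : num_dvd p z -> num_dvd p (k%:~R * z).
Proof.
move=> /num_dvdP[a [b [pa pb ->]]]; apply/num_dvdP; exists (k * a), b.
by rewrite dvdz_mull // rmorphM mulrA.
Qed.

Lemma pow_div_num_dvd (s n : nat) :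
  (0 < n)%N -> ~~ (p ^ s %| n)%N -> num_dvd p ((p ^ s)%:R / n%:R).
Proof.
move=> n0 psn.
have [k pk nE] := pfactor_coprime p_prime n0.
have ls : (logn p n < s)%N by rewrite ltnNge -pfactor_dvdn.
apply/num_dvdP; exists (p ^ (s - logn p n))%:Z, k%:Z; split.
- by rewrite dvdzE /= dvdn_exp // subn_gt0.
- by rewrite dvdzE /= -prime_coprime.
- rewrite [in LHS]nE natrM invfM mulrCA mulrC -!pmulrn.
  congr (_ / _); rewrite -{1}(subnK (ltnW ls)) expnD natrM mulfK //.
  by rewrite pnatr_eq0 expn_eq0 negb_and -lt0n prime_gt0.
Qed.

Lemma pow_denq_num_dvd (s : nat) (z : rat) :
  ~~ ((p ^ s)%:Z %| denq z)%Z -> num_dvd p ((p ^ s)%:R * z).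
Proof.
move=> psz; have d0 : (0 < `|denq z|)%N by rewrite absz_gt0.
rewrite -[z]divq_num_den mulrCA num_dvdMz //.
have -> : (denq z)%:~R = (`|denq z|%N)%:R :> rat.
  by rewrite pmulrn gez0_abs // ltW.
by rewrite pow_div_num_dvd.
Qed.

Lemma harmonic_numberS (n : nat) :
  harmonic_number n.+1 = harmonic_number n + n.+1%:R^-1.
Proof. by rewrite /harmonic_number big_nat_recr. Qed.

(** By induction on [n]: the term of index [n.+1] is cancelled by the new term of
    [harmonic_number (n.+1 %/ p ^ s)] if [p ^ s] divides [n.+1], and vanishes
    modulo [p] otherwise. *)
Lemma num_dvd_harmonic_shift (s n : nat) :
  num_dvd p ((p ^ s)%:R * harmonic_number n - harmonic_number (n %/ p ^ s)).
Proof.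
have ps0 : (0 < p ^ s)%N by rewrite expn_gt0 prime_gt0.
elim: n => [|n IH].
  by rewrite div0n /harmonic_number big_geq // mulr0 subr0 -[0]/(0%:~R) num_dvd_int dvdz0.
rewrite divnS //; case: (boolP (p ^ s %| n.+1)%N) => psn; last first.
  by rewrite add0n harmonic_numberS mulrDr addrAC num_dvdD // pow_div_num_dvd.
have qE : ((n %/ p ^ s).+1 * p ^ s = n.+1)%N.
  by rewrite -add1n -[1%N]/(nat_of_bool true) -psn -divnS // divnK.
rewrite add1n !harmonic_numberS mulrDr opprD addrACA num_dvdD // -qE natrM.
rewrite invfM mulrCA mulfV ?mulr1 ?subrr ?pnatr_eq0 -?lt0n //.
by rewrite -[0]/(0%:~R) num_dvd_int dvdz0.
Qed.

Lemma I_set_quotient (a s n : nat) : (a <= s)%N ->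
  I_set (p ^ a) n -> num_dvd p (harmonic_number (n %/ p ^ s)).
Proof.
move=> le_as [_ pa_n].
rewrite -[harmonic_number _](subKr ((p ^ s)%:R * harmonic_number n)).
rewrite num_dvdB ?num_dvd_harmonic_shift // pow_denq_num_dvd //.
apply: contra pa_n; apply: dvdz_trans.
by rewrite dvdzE dvdn_exp2l.
Qed.

(** The rising product [(X + 1) ... (X + d)], over any ring so that integer values
    can be read both in the rationals and modulo [p]. *)
Definition rising (R : nzRingType) (d : nat) : {poly R} :=
  \prod_(1 <= j < d.+1) ('X + j%:R%:P).

Lemma risingS (R : nzRingType) d : rising R d.+1 = rising R d * ('X + d.+1%:R%:P).
Proof. by rewrite /rising big_nat_recr. Qed.

(** The logarithmic derivative of the rising product at [n] is the sum of the
    [1 / (n + j)]; multiplying by the product clears all denominators. *)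
Lemma horner_deriv_rising (d n : nat) : ((rising rat d)^`()).[n%:R] =
  (rising rat d).[n%:R] * (harmonic_number (n + d) - harmonic_number n).
Proof.
elim: d => [|d IH].
  by rewrite addn0 subrr mulr0 /rising big_geq // derivC horner0.
rewrite risingS derivM derivD derivX derivC addr0 mulr1 hornerD !hornerM IH.
rewrite addnS harmonic_numberS !hornerE -natrD addnS.
have : (n + d).+1%:R != 0 :> rat by rewrite pnatr_eq0.
by move: (n + d).+1%:R => t t0; field.
Qed.

Lemma map_rising (R S : nzRingType) (f : {rmorphism R -> S}) d :
  map_poly f (rising R d) = rising S d.
Proof.
rewrite /rising rmorph_prod; apply: eq_bigr => j _.
by rewrite rmorphD /= map_polyX map_polyC /= rmorph_nat.
Qed.

Lemma root_deriv_rising (d n : nat) :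
  num_dvd p (harmonic_number n) -> num_dvd p (harmonic_number (n + d)) ->
  root (rising 'F_p d)^`() n%:R.
Proof.
move=> pn pnd.
have map_val (R : nzRingType) : ((rising int d)^`()).[n%:Z]%:~R = ((rising R d)^`()).[n%:R].
  rewrite -(map_rising (@intmul R 1)) deriv_map.
  by rewrite -[n%:R]/(n%:Z%:~R) horner_map.
have val_z : (p%:Z %| ((rising int d)^`()).[n%:Z])%Z.
  rewrite -num_dvd_int map_val horner_deriv_rising.
  have -> : (rising rat d).[n%:R] = ((rising int d).[n%:Z])%:~R.
    by rewrite -(map_rising (@intmul rat 1)) -[n%:R]/(n%:Z%:~R) horner_map.
  by rewrite num_dvdMz // num_dvdB.
rewrite /root -map_val; move: val_z => /dvdzP[k ->].
by rewrite rmorphM /= -pmulrn pchar_Fp_0 // mulr0.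
Qed.

Lemma size_rising (R : idomainType) d : size (rising R d) = d.+1.
Proof.
rewrite /rising; under eq_bigr => j _ do rewrite -[_%:P]opprK -polyCN.
by rewrite size_prod_XsubC size_iota subn1.
Qed.

(** The leading coefficient is [d], a unit modulo [p] since [0 < d < p]. *)
Lemma deriv_rising_neq0 d : (0 < d < p)%N -> (rising 'F_p d)^`() != 0.
Proof.
case: d => // d /andP[_ dp]; apply/negP => /eqP/(congr1 (fun q : {poly _} => q`_d)).
rewrite coef_deriv coef0 => /eqP; rewrite -mulr_natr mulf_eq0.
rewrite -(dvdn_pcharf (pchar_Fp p_prime)) gtnNdvd // orbF.
have -> : (rising 'F_p d.+1)`_d.+1 = lead_coef (rising 'F_p d.+1).
  by rewrite lead_coefE size_rising.
by rewrite lead_coef_eq0 -size_poly_eq0 size_rising.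
Qed.

(** The integers counted are distinct modulo [p], as they lie in a window of
    length [p], and are roots of a polynomial of degree less than [d].
    The bound also covers [p <= d], where no two elements are [d] apart. *)
Lemma count_harmonic_gap_le (u d : nat) (s : seq nat) : (0 < d)%N ->
  uniq s -> {in s, forall r, (u <= r < u + p)%N /\ num_dvd p (harmonic_number r)} ->
  (count (fun r => (r + d)%N \in s) s <= d.-1)%N.
Proof.
move=> d0 s_uniq sP.
have [pd|dp] := leqP p d.
  rewrite (@eq_in_count _ _ pred0) ?count_pred0 // => r rs /=; apply/negP => rds.
  by have [+ _] := sP r rs; have [+ _] := sP _ rds; lia.
have d_bnd : (0 < d < p)%N by rewrite d0.
rewrite -size_filter; set s' := filter _ s.
have f0 := deriv_rising_neq0 d_bnd.
have inj : {in s' &, injective (fun r => r%:R : 'F_p)}.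
  have : {in s' &, forall r r', (r <= r')%N -> r%:R = r'%:R :> 'F_p -> r = r'}.
    move=> r r'; rewrite !mem_filter => /andP[_ /sP[/andP[r1 r2] _]].
    move=> /andP[_ /sP[/andP[r3 r4] _]] le /esym eq.
    apply/eqP; rewrite eqn_leq le /= -subn_eq0.
    move/eqP: eq; rewrite -subr_eq0 -natrB // -(dvdn_pcharf (pchar_Fp p_prime)).
    by case: posnP => // rr' /(dvdn_leq rr'); lia.
  by move=> H r r' rs r's e; case: (leqP r r') => [|/ltnW] le; [apply: H | apply/esym/H].
have := @max_poly_roots _ _ [seq (r%:R : 'F_p) | r <- s'] f0.
rewrite size_map map_inj_in_uniq // filter_uniq // => /(_ _ isT) lt.
have {}lt : (size s' < size (rising 'F_p d)^`())%N.
  apply: lt; apply/allP => _ /mapP[r + ->]; rewrite mem_filter => /andP[rd rs].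
  by apply: root_deriv_rising; [case: (sP r rs)|case: (sP _ rd)].
have : (size (rising 'F_p d)^`() < d.+1)%N.
  by rewrite -[X in (_ < X)%N](size_rising 'F_p) lt_size_deriv // -size_poly_eq0 size_rising.
move: lt; lia.
Qed.

Lemma count_harmonic_block (u t : nat) : (t < p)%N ->
  (8 * (count (fun r => num_dvd p (harmonic_number r)) (iota u t.+1)) ^ 3 <= 9 * t.+1 ^ 2)%N.
Proof.
move=> tp; rewrite -size_filter; set s := filter _ _.
have s_sorted : sorted ltn s by apply: sorted_filter (iota_ltn_sorted _ _); exact: ltn_trans.
have sP r : r \in s -> (u <= r <= u + t)%N /\ num_dvd p (harmonic_number r).
  by rewrite mem_filter mem_iota addnS ltnS => /andP[].
have s_uniq : uniq s by rewrite filter_uniq ?iota_uniq.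
have := @count_harmonic_gap_le u _ s _ s_uniq; clearbody s.
case: s s_sorted sP s_uniq => [|x s] //= xs sP s_uniq gaps.
apply: span_cubic_bound => D.
have := @sparse_sorted_span D x s xs.
have [xu _] := sP x (mem_head _ _); have [lu _] := sP (last x s) (mem_last _ _).
move=> span; have {span} : (D * size s + x <= last x s + 'C(D, 3))%N; last by lia.
apply: span => d /andP[d0 _]; apply: gaps => // r /sP[rb r0]; split => //; lia.
Qed.
End PAdic.

(** * From one base-[p] digit to all of them *)

(** Used with [q = p] to append one constrained digit, and with [q = p ^ a] to
    append [a] free digits (then [A = q]). *)
Lemma count_by_quotient_le (R : numDomainType) (q : nat) (A : R) (S T : pred nat) (c : nat) :
  (0 < q)%N -> 0 <= A ->
  (forall n, S n -> T (n %/ q)%N) ->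
  (forall b, (count S (iota (q * b) q))%:R <= A) ->
  (count S (iota 0 (q * c)))%:R <= A * (count T (iota 0 c))%:R.
Proof.
move=> q0 A0 ST block; elim: c => [|c IH]; first by rewrite muln0 mulr0.
rewrite mulnS addnC iotaD count_cat natrD -addn1 iotaD count_cat natrD mulrDr.
apply: lerD => //=; rewrite !add0n addn0.
have [Tc|nTc] := boolP (T c); first by rewrite mulr1.
rewrite mulr0 (@eq_in_count _ _ pred0) ?count_pred0 // => n.
rewrite mem_iota => /andP[le lt]; apply/negP => /ST; apply/negP.
suff -> : (n %/ q = c)%N by [].
apply/eqP; rewrite eqn_leq leq_divRL // mulnC le andbT -ltnS ltn_divLR // mulSn.
by rewrite addnC mulnC.
Qed.

(** The exponent is chosen so that [p `^ rate = p `^ (2 / 3) * expR (1 / 25)]. *)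
Definition rate (R : realType) (p : nat) : R := 2 / 3 + 1 / (25 * ln p%:R).

Section Rate.
Variable R : realType.

Lemma rate_ge (p : nat) : (2 / 3 : R) <= rate R p.
Proof.
rewrite lerDl divr_ge0 // mulr_ge0 //; case: p => [|p]; first by rewrite ln0.
by rewrite ln_ge0 // ler1n.
Qed.

Lemma rate_ge0 (p : nat) : 0 <= rate R p.
Proof. by apply: le_trans (rate_ge p); lra. Qed.

Lemma cube_powR (a s : R) : (a `^ s) ^+ 3 = a `^ (s * 3).
Proof. by rewrite -powR_mulrn ?powR_ge0 // -powRrM. Qed.

Lemma powR_rate (p : nat) : (1 < p)%N -> (p%:R : R) `^ (3 * rate R p) = p%:R ^+ 2 * expR (3 / 25).
Proof.
move=> p1; have lnp : ln p%:R != 0 :> R by rewrite gt_eqF // ln_gt0 // ltr1n.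
have p0 : p%:R != 0 :> R by rewrite pnatr_eq0 -lt0n ltnW.
have -> : 3 * rate R p = 2%:R + 3 / (25 * ln p%:R) by rewrite /rate; field.
rewrite powRD ?p0 ?implybT // powR_mulrn // [in X in _ * X]/powR (negbTE p0).
by congr (_ * expR _); field.
Qed.

Lemma block_count_le_powR (p c : nat) : (1 < p)%N -> (8 * c ^ 3 <= 9 * p ^ 2)%N ->
  c%:R <= (p%:R : R) `^ rate R p.
Proof.
move=> p1 cp; rewrite -(@ler_pXn2r _ 3) ?nnegrE ?powR_ge0 // cube_powR mulrC powR_rate //.
have e98 : (9 / 8 : R) <= expR (3 / 25).
  (* [1 + x <= expR x] at [3 / 25] or even [1 / 25] is too weak; the sixth
     power of the bound at [1 / 50] suffices. *)
  have -> : (3 / 25 : R) = 6%:R * (1 / 50) by field.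
  rewrite expRM_natl; apply: (@le_trans _ _ ((1 + 1 / 50) ^+ 6)); first by lra.
  by rewrite lerXn2r ?nnegrE ?expR_ge0 ?expR_ge1Dx //; lra.
move: cp; rewrite -(ler_nat R) (natrM R 8) (natrM R 9) !natrX => cp.
apply: (@le_trans _ _ (p%:R ^+ 2 * (9 / 8))); first by lra.
by rewrite ler_wpM2l // exprn_ge0.
Qed.

(** The constant [2] pays for a leading digit at most [t], which may leave its
    block incomplete: [t.+1 <= 2 * t] and [9 * 4 <= 8 * 8]. *)
Lemma initial_count_le_powR (s : R) (t c : nat) : 2 / 3 <= s -> (0 < t)%N ->
  (8 * c ^ 3 <= 9 * t.+1 ^ 2)%N -> c%:R <= 2 * (t%:R : R) `^ s.
Proof.
move=> s23 t0 ct; apply: (@le_trans _ _ (2 * t%:R `^ (2 / 3))); last first.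
  by rewrite ler_pM2l // ler_powR // ler1n.
rewrite -(@ler_pXn2r _ 3) ?nnegrE ?mulr_ge0 ?powR_ge0 // exprMn cube_powR divfK ?pnatr_eq0 //.
rewrite powR_mulrn // -!natrX -natrM ler_nat.
have : (t.+1 ^ 2 <= (2 * t) ^ 2)%N by rewrite leq_exp2r //; lia.
by rewrite expnMn; lia.
Qed.

(** By induction on the number of digits: each last digit multiplies the count by
    at most [p `^ rate], as it does the bound, and the leading digit is handled
    by [initial_count_le_powR]. *)
Lemma harmonic_tree_count (p M : nat) (Q : pred nat) : prime p -> (0 < M)%N ->
  (forall n, Q n -> num_dvd p (harmonic_number n)) ->
  (forall n, Q n -> Q (n %/ p)%N) ->
  (count Q (iota 0 M.+1))%:R <= 2 * (M%:R : R) `^ rate R p.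
Proof.
move=> pp M0 QJ Qp; have p1 := prime_gt1 pp.
elim/ltn_ind: M M0 => M IH M0.
have [Mp|pM] := ltnP M p.
  apply: initial_count_le_powR (rate_ge p) M0 _.
  apply: leq_trans (count_harmonic_block pp 0 Mp).
  by rewrite leq_mul2l leq_exp2r // sub_count.
have M'0 : (0 < M %/ p)%N by rewrite divn_gt0 // ltnW.
have M'M : (M %/ p < M)%N by rewrite ltn_Pdiv.
have step : (count Q (iota 0 (p * (M %/ p).+1)))%:R <=
    (p%:R : R) `^ rate R p * (count Q (iota 0 (M %/ p).+1))%:R.
  apply: count_by_quotient_le; rewrite ?powR_ge0 // ?(ltnW p1) // => b.
  apply: block_count_le_powR => //.
  have := @count_harmonic_block p pp (p * b) p.-1.
  rewrite prednK ?(ltnW p1) // => /(_ (leqnn p)).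
  by apply: leq_trans; rewrite leq_mul2l leq_exp2r // sub_count.
apply: (le_trans _ (le_trans step _)).
  rewrite ler_nat -(subnKC (_ : M.+1 <= p * (M %/ p).+1)%N) ?iotaD ?count_cat ?leq_addr //.
  by rewrite mulnC ltn_ceil // ltnW.
apply: (le_trans (ler_wpM2l (powR_ge0 _ _) (IH _ M'M M'0))).
rewrite mulrCA ler_pM2l // -powRM // -natrM ge0_ler_powR ?nnegrE ?rate_ge0 //.
by rewrite ler_nat mulnC leq_trunc_div.
Qed.

(** If [N < p ^ a] the trivial bound [N] is good enough.  Otherwise the count is at
    most [p ^ a] times that of [harmonic_tree_count] up to [M = N %/ p ^ a], and
    [p ^ a * M `^ t <= (p ^ a) `^ (1 / 3) * N `^ t] because [2 / 3 <= t]. *)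
Lemma I_set_prime_power_count (p a N : nat) : prime p ->
  (count (fun n => `[< I_set (p ^ a) n >]) (iota 1 N))%:R
    <= 2 * ((p ^ a)%:R : R) `^ (1 / 3) * N%:R `^ rate R p.
Proof.
move=> pp; have pa0 : (0 < p ^ a)%N by rewrite expn_gt0 prime_gt0.
have [N0|N0] := posnP N; first by rewrite N0 /= !mulr_ge0 ?powR_ge0.
have N1 : 1 <= N%:R :> R by rewrite ler1n.
have pa1 : 1 <= (p ^ a)%:R :> R by rewrite ler1n.
have [Npa|paN] := ltnP N (p ^ a).
  apply: (@le_trans _ _ N%:R).
    by rewrite ler_nat (leq_trans (count_size _ _)) // size_iota.
  apply: (@le_trans _ _ (((p ^ a)%:R : R) `^ (1 / 3) * N%:R `^ (2 / 3))).
    apply: (@le_trans _ _ ((N%:R : R) `^ (1 / 3) * N%:R `^ (2 / 3))).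
      rewrite -powRD ?pnatr_eq0 -?lt0n ?N0 ?implybT //.
      have -> : (1 / 3 + 2 / 3 : R) = 1 by field.
      by rewrite powRr1.
    rewrite ler_wpM2r ?powR_ge0 // ge0_ler_powR ?nnegrE //; first by lra.
    by rewrite ler_nat ltnW.
  rewrite -mulrA; apply: (@le_trans _ _ (((p ^ a)%:R : R) `^ (1 / 3) * N%:R `^ rate R p)).
    by rewrite ler_wpM2l ?powR_ge0 // ler_powR ?rate_ge.
  by rewrite ler_peMl ?mulr_ge0 ?powR_ge0 //; lra.
pose Q n := `[< forall s, num_dvd p (harmonic_number (n %/ p ^ s)) >].
pose S n := Q (n %/ p ^ a)%N.
set M := (N %/ p ^ a)%N.
have M0 : (0 < M)%N by rewrite divn_gt0.
have QJ n : Q n -> num_dvd p (harmonic_number n).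
  by move=> /asboolP/(_ 0%N); rewrite divn1.
have Qp n : Q n -> Q (n %/ p)%N.
  by move=> /asboolP Qn; apply/asboolP => s; rewrite -divnMA -expnS.
have IS : (count (fun n => `[< I_set (p ^ a) n >]) (iota 1 N) <= count S (iota 0 (p ^ a * M.+1)))%N.
  apply: (@leq_trans (count S (iota 1 N))).
    apply: sub_count => n /asboolP In; apply/asboolP => s.
    by rewrite -divnMA -expnD (I_set_quotient pp (leq_addr _ _) In).
  apply: (@leq_trans (count S (iota 0 N.+1))); first by rewrite /= leq_addl.
  rewrite -(subnKC (_ : N.+1 <= p ^ a * M.+1)%N) ?iotaD ?count_cat ?leq_addr //.
  by rewrite mulnC ltn_ceil.
apply: (@le_trans _ _ ((p ^ a)%:R * (count Q (iota 0 M.+1))%:R)).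
  apply: (@le_trans _ _ (count S (iota 0 (p ^ a * M.+1)))%:R); first by rewrite ler_nat.
  apply: count_by_quotient_le => // b.
  by rewrite ler_nat (leq_trans (count_size _ _)) // size_iota.
apply: (le_trans (ler_wpM2l _ (harmonic_tree_count pp M0 QJ Qp))) => //.
rewrite mulrCA -[leRHS]mulrA ler_pM2l //.
have {1}-> : (p ^ a)%:R = ((p ^ a)%:R : R) `^ (1 / 3) * (p ^ a)%:R `^ (2 / 3).
  rewrite -powRD; first by rewrite -[LHS]powRr1 //; congr (_ `^ _); field.
  by rewrite pnatr_eq0 -lt0n pa0 implybT.
rewrite -mulrA ler_wpM2l ?powR_ge0 //.
apply: (@le_trans _ _ (((p ^ a)%:R : R) `^ rate R p * M%:R `^ rate R p)).
  by rewrite ler_wpM2r ?powR_ge0 // ler_powR ?rate_ge.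
rewrite -powRM // -natrM ge0_ler_powR ?nnegrE ?rate_ge0 //.
by rewrite ler_nat mulnC leq_trunc_div.
Qed.

End Rate.

(** * Assembling the prime powers *)

Lemma size_primes_part (p n : nat) : p \in primes n ->
  size (primes n) = (size (primes n`_p^')).+1.
Proof.
move=> pn; rewrite primes_part size_filter -(count_predC (pred1 p) (primes n)).
by rewrite count_uniq_mem ?primes_uniq // pn.
Qed.

Lemma exp2_size_primes_le (n : nat) : (0 < n)%N -> (2 ^ size (primes n) <= n)%N.
Proof.
elim/ltn_ind: n => n IH n0; have [n1|n1] := leqP n 1.
  by have -> : n = 1%N by lia.
set p := pdiv n; have pp : prime p by apply: pdiv_prime.
have pn : p \in primes n by rewrite mem_primes pp n0 pdiv_dvd.
have np : (2 <= n`_p)%N.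
  rewrite p_part (leq_trans (prime_gt1 pp)) //.
  by rewrite -{1}(expn1 p) leq_exp2l ?prime_gt1 // logn_gt0.
have n'0 : (0 < n`_p^')%N by rewrite part_gt0.
rewrite (size_primes_part pn) -{2}(partnC p n0) expnS leq_mul // IH //.
by rewrite -{2}(partnC p n0) ltn_Pmull.
Qed.

Lemma cube_le_exp2 (k : nat) : (k ^ 3 <= 2 ^ (k + 2))%N.
Proof.
elim: k => // k IH; have [k4|k4] := leqP k 4; first by case: k k4 {IH} => [|[|[|[|[|]]]]].
rewrite addSn (expnS 2); apply: leq_trans (_ : 2 * k ^ 3 <= _)%N; last by rewrite leq_mul2l IH.
have [j ->] : exists j, (k = j + 5)%N by exists (k - 5)%N; lia.
rewrite !expnS !expn0; nia.
Qed.

(** The part of [m] prime to [p] has one prime factor less than [m], hence is at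
    least [2 ^ (size (primes m)).-1]. *)
Lemma cube_omega_part_le (m p : nat) : (0 < m)%N -> p \in primes m ->
  (size (primes m) ^ 3 * m`_p <= 8 * m)%N.
Proof.
move=> m0 pm.
rewrite -{3}(partnC p m0) mulnCA mulnC leq_mul2l; apply/orP; right.
apply: leq_trans (cube_le_exp2 _) _; rewrite (size_primes_part pm) addSn -addnS addnC expnD.
by rewrite leq_mul2l exp2_size_primes_le ?part_gt0.
Qed.

Lemma I_set_prime_power (m n : nat) : (0 < m)%N -> I_set m n ->
  exists2 p, p \in primes m & I_set m`_p n.
Proof.
move=> m0 [n0 nm]; apply: contrapT => no_p; case/negP: nm.
rewrite dvdzE /=; apply/dvdn_partP => // p; rewrite -[p \in \pi(m)]/(p \in primes m) => pm.
apply/negPn/negP => np; apply: no_p; exists p => //; split => //.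
Qed.

Theorem theorem1p2 (R : realType) (m : nat) (x : R)
  (hm : (2 <= m)%N) (hx : 0 < x) :
  (counting (I_set m) x)%:R <=
    4 * m%:R `^ (1 / 3) * x `^ (2 / 3 + 1 / (25 * ln (pdiv m)%:R)) :> R.
Proof.
rewrite -/(rate R (pdiv m)).
have m0 : (0 < m)%N by apply: ltnW.
set N := Num.truncn x.
have Nx : N%:R <= x by rewrite truncn_le ltW.
pose C p := count (fun n => `[< I_set m`_p n >]) (iota 1 N).
have cover : (counting (I_set m) x <= \sum_(p <- primes m) C p)%N.
  have mem_N n : [set n | 1 <= (n%:R : R) <= x]%classic n -> n \in iota 1 N.
    by move=> /andP[n1 nx]; rewrite mem_iota -(ler1n R) n1 add1n ltnS truncn_ge_nat // ltW.
  have fin : finite_set (I_set m `&` [set n | 1 <= (n%:R : R) <= x])%classic.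
    apply: sub_finite_set (finite_II N.+1) => n [_ /mem_N]; rewrite mem_iota /=; lia.
  apply: (@leq_trans (count (fun n => `[< I_set m n >]) (iota 1 N))).
    rewrite /counting -size_filter; apply: uniq_leq_size (fset_uniq _) _ => n.
    rewrite in_fset_set // inE => -[In /mem_N nN].
    by rewrite mem_filter nN andbT; apply/asboolP.
  elim: (iota 1 N) @C => [|n s IH] /=; first by rewrite big1.
  rewrite big_split leq_add //=; case: asboolP => // /(I_set_prime_power m0)[p pm Ip].
  by rewrite (big_rem p) //= (introT (asboolP _) Ip).
have [N0|N0] := posnP N.
  apply: (@le_trans _ _ (\sum_(p <- primes m) C p)%:R); first by rewrite ler_nat.
  by rewrite /C N0 big1 //= !mulr_ge0 ?powR_ge0.
set k := size (primes m).
have k0 : (0 < k)%N.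
  have : pdiv m \in primes m by rewrite mem_primes pdiv_prime // m0 pdiv_dvd.
  by rewrite /k; case: (primes m).
have each p : p \in primes m ->
    (C p)%:R <= 4 * (m%:R : R) `^ (1 / 3) * x `^ rate R (pdiv m) / k%:R.
  move=> pm; have pp : prime p by move: pm; rewrite mem_primes => /and3P[].
  rewrite /C p_part; apply: le_trans (I_set_prime_power_count R _ N pp) _.
  rewrite -p_part.
  rewrite ler_pdivlMr ?ltr0n // mulrAC.
  apply: ler_pM; rewrite ?mulr_ge0 ?powR_ge0 //.
    rewrite -mulrA (_ : 4 = 2 * 2 :> R); last by ring.
    rewrite -mulrA ler_pM2l // -(@ler_pXn2r _ 3) ?nnegrE ?mulr_ge0 ?powR_ge0 //.
    (* Cubing reduces the claim to [k ^ 3 * m`_p <= 8 * m]. *)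
    rewrite !exprMn !cube_powR !divfK ?pnatr_eq0 // !powRr1 // -!natrX -!natrM ler_nat mulnC.
    exact: cube_omega_part_le.
  apply: (@le_trans _ _ (N%:R `^ rate R (pdiv m))).
    rewrite ler_powR ?ler1n // lerD2l.
    have q1 : (1 < pdiv m)%N by rewrite prime_gt1 ?pdiv_prime.
    have qp : (pdiv m <= p)%N.
      by rewrite pdiv_min_dvd ?prime_gt1 //; move: pm; rewrite mem_primes => /and3P[].
    rewrite ler_pM2l // lef_pV2 ?posrE ?mulr_gt0 ?ln_gt0 ?ltr1n ?(prime_gt1 pp) //.
    by rewrite ler_pM2l // ler_ln ?posrE ?ltr0n ?ler_nat // ltnW // prime_gt1.
  by rewrite ge0_ler_powR ?nnegrE ?rate_ge0 // ltW.
apply: (@le_trans _ _ (\sum_(p <- primes m) C p)%:R); first by rewrite ler_nat.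
rewrite natr_sum.
apply: (@le_trans _ _ (\sum_(p <- primes m)
   (4 * (m%:R : R) `^ (1 / 3) * x `^ rate R (pdiv m) / k%:R))).
  by rewrite big_seq [leRHS]big_seq; apply: ler_sum.
rewrite big_const_seq count_predT iter_addr_0 -/k -[X in X <= _]mulr_natr divfK //.
by rewrite pnatr_eq0 -lt0n.
Qed.
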